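(* Let $C^1$ and $C^2$ be two compact sets in $(\mathbb{R}^d,\operatorname{dist})$, generated by systems of balls $\{S_I^1\}_I$ and $\{S_L^2\}_L$ respectively, and fix $r\in(0,\tfrac12)$. Assume: (i) $\tau(C^1,\{S_I^1\}_I)\,\tau(C^2,\{S_L^2\}_L)\ge \frac{1}{(1-2r)^2}$; (ii) $C^1\cap (1-2r)S^2_\emptyset\neq\emptyset$; (iii) $\operatorname{rad}(S^1_\emptyset)\ge r\operatorname{rad}(S^2_\emptyset)$ and $\operatorname{rad}(S^2_\emptyset)\ge r\operatorname{rad}(S^1_\emptyset)$; (iv) $\{S_I^1\}_I$ and $\{S_L^2\}_L$ are both $r$-uniformly dense. Then $C^1\cap C^2\neq\emptyset$.
   Context: $\mathbb{R}^d$ is equipped with a distance $\operatorname{dist}$ induced by a norm; all balls are closed balls for this distance; $\operatorname{rad}(B)$ is the radius of a ball $B$, and for $a>0$, $aB$ is the ball with the same center as $B$ and radius $a\operatorname{rad}(B)$. A word $I$ is a finite sequence of natural numbers, $\ell(I)$ its length, $\emptyset$ the empty word. A system of balls for a compact set $C\subseteq\mathbb{R}^d$ is a family $\{S_I\}_I$ of closed balls indexed by words such that each $S_I$ contains its finitely many children $S_{I,j}$, $1\le j\le k_I$ (no separation assumed), $C=\bigcap_{n\ge0}\bigcup_{\ell(I)=n}S_I$, and for every infinite sequence of indices $i_1,i_2,\dots$ of the construction, $\operatorname{rad}(S_{i_1\cdots i_n})\to0$. For each word $I$ set $h_I:=\max_{x\in S_I}\operatorname{dist}(x,C)$. The thickness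 of $C$ associated to the system is $\tau(C,\{S_I\}_I):=\inf_{n\ge0}\inf_{\ell(I)=n}\frac{\min_i\operatorname{rad}(S_{I,i})}{h_I}$. The system $\{S_I\}_I$ is $r$-uniformly dense if for every word $I$ and every ball $B\subseteq S_I$ with $\operatorname{rad}(B)\ge r\operatorname{rad}(S_I)$ there is a child $S_{I,i}\subseteq B$. *)

(* Defs.v *)
From HB Require Import structures.
From mathcomp Require Import all_boot all_order all_algebra.
From mathcomp Require Import all_classical all_reals all_analysis.
Set Implicit Arguments. Unset Strict Implicit. Unset Printing Implicit Defensive.
Import Order.TTheory GRing.Theory Num.Theory.
Import numFieldNormedType.Exports.
Local Open Scope classical_set_scope.
Local Open Scope ring_scope.

Section Defs.
Variables (R : realType) (d : nat).
Notation V := 'rV[R]_d.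

Definition is_norm (N : V -> R) : Prop :=
  [/\ forall x, N x = 0 -> x = 0,
      forall (a : R) x, N (a *: x) = `|a| * N x &
      forall x y, N (x + y) <= N x + N y].

Definition ndist (N : V -> R) (x y : V) : R := N (x - y).

Definition ballT := (V * R)%type.
Definition bcenter (B : ballT) : V := B.1.
Definition brad (B : ballT) : R := B.2.

Definition nball (N : V -> R) (B : ballT) : set V :=
  [set x | ndist N x (bcenter B) <= brad B].

Definition scale_nball (a : R) (B : ballT) : ballT := (bcenter B, a * brad B).

Definition word_of (k : seq nat -> nat) (I : seq nat) : Prop :=
  forall n, (n < size I)%N -> (nth 0%N I n < k (take n I))%N.

(* A system of balls for C: S I is the ball of word I, k I its number of
   children, the children of I being the words rcons I j, j < k I. *)
Definition system_of_balls (N : V -> R) (C : set V)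
    (S : seq nat -> ballT) (k : seq nat -> nat) : Prop :=
  [/\ (forall I, word_of k I -> 0 < brad (S I)),
      (forall I j, word_of k I -> (j < k I)%N ->
          nball N (S (rcons I j)) `<=` nball N (S I)),
      C = \bigcap_(n in [set: nat])
            \bigcup_(I in [set I | word_of k I /\ size I = n]) nball N (S I) &
      (forall i : nat -> nat, (forall n, (i n < k (mkseq i n))%N) ->
          (fun n => brad (S (mkseq i n))) @ \oo --> (0 : R))].

Definition dist_set (N : V -> R) (x : V) (C : set V) : R :=
  inf [set ndist N x y | y in C].

Definition hgtS (N : V -> R) (C : set V) (B : ballT) : R :=
  sup [set dist_set N x C | x in nball N B].

Definition thick_ratio (N : V -> R) (C : set V)
    (S : seq nat -> ballT) (k : seq nat -> nat) (I : seq nat) : \bar R :=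
  let m := \big[Order.min/+oo%E]_(i < k I) (brad (S (rcons I i)))%:E in
  if hgtS N C (S I) == 0 then +oo%E else (m * (hgtS N C (S I))^-1%:E)%E.

Definition thicknessS (N : V -> R) (C : set V)
    (S : seq nat -> ballT) (k : seq nat -> nat) : \bar R :=
  ereal_inf [set thick_ratio N C S k I | I in word_of k].

Definition unif_dense (N : V -> R) (r : R)
    (S : seq nat -> ballT) (k : seq nat -> nat) : Prop :=
  forall I, word_of k I -> forall B : ballT,
    nball N B `<=` nball N (S I) -> r * brad (S I) <= brad B ->
    exists2 j, (j < k I)%N & nball N (S (rcons I j)) `<=` nball N B.

End Defs.

(* Main.v *)
(** Call a ball [S^a_I] linked when the other set [C^b] meets [(1-2r) S^a_I], say
at [y].  Following a branch of the system [S^b] towards [y], let [S^b_L] be the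
last ball of radius at least [r rad(S^a_I)] and [S^b_{L,j}] the next one.  Then
[S^a_I] and [S^b_L] share a ball of radius [r rad(S^a_I)], hence [S^b_L] contains
a child [S^a_{I,i}], while [S^b_{L,j}] is contained in [S^a_I].  By the thickness
hypothesis [h_L <= (1-2r) rad(S^a_{I,i})] or [h_I <= (1-2r) rad(S^b_{L,j})], so
[S^a_{I,i}] or [S^b_{L,j}] is linked.  Iterating gives linked balls of arbitrarily
small radius; as every ball of a system meets the corresponding set, the distance
between the two compact sets is zero. *)

Require Import Defs.
From mathcomp Require Import all_boot all_order all_algebra.
From mathcomp Require Import all_classical all_reals all_analysis.
From mathcomp Require Import lra ring.
Set Implicit Arguments. Unset Strict Implicit. Unset Printing Implicit Defensive.
Import Order.TTheory GRing.Theory Num.Theory.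
Import numFieldNormedType.Exports.
Local Open Scope classical_set_scope.
Local Open Scope ring_scope.

(** * Norms on R^d: comparison with the max norm, closed balls, compactness *)

Section Norms.
Context {R : realType} {d : nat} {N : 'rV[R]_d -> R}.
Hypothesis normN : is_norm N.

Lemma is_normZ a x : N (a *: x) = `|a| * N x.
Proof. by case: normN. Qed.

Lemma is_normD x y : N (x + y) <= N x + N y.
Proof. by case: normN. Qed.

Lemma is_norm0 : N 0 = 0.
Proof. by rewrite -(scale0r 0) is_normZ normr0 mul0r. Qed.

Lemma is_normN x : N (- x) = N x.
Proof. by rewrite -scaleN1r is_normZ normrN1 mul1r. Qed.

Lemma is_norm_ge0 x : 0 <= N x.
Proof. by have := is_normD x (- x); rewrite subrr is_norm0 is_normN; lra. Qed.

Lemma is_norm_gt0 x : x != 0 -> 0 < N x.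
Proof.
move=> x0; rewrite lt_def is_norm_ge0 andbT; apply: contra_neq x0.
by case: normN => + _ _; apply.
Qed.

Lemma ndistxx x : ndist N x x = 0.
Proof. by rewrite /ndist subrr is_norm0. Qed.

Lemma ndistC x y : ndist N x y = ndist N y x.
Proof. by rewrite /ndist -is_normN opprB. Qed.

Lemma ndist_ge0 x y : 0 <= ndist N x y.
Proof. exact: is_norm_ge0. Qed.

Lemma ndist_triangle y x z : ndist N x z <= ndist N x y + ndist N y z.
Proof. by rewrite /ndist -[x - z](subrKA y) is_normD. Qed.

(** Expand [x] in the standard basis and bound every coordinate by the max norm. The added 1 keeps
    the constant positive even when [d] is 0. *)
Lemma is_norm_le_mx_norm : exists2 K, 0 < K & forall x, N x <= K * `|x|.
Proof.
exists (1 + \sum_(j < d) N (delta_mx 0 j)) => [|x].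
  by rewrite ltr_pwDl // sumr_ge0 // => j _; exact: is_norm_ge0.
apply: (@le_trans _ _ (\sum_(j < d) N (x 0 j *: delta_mx 0 j))).
  rewrite {1}[x]row_sum_delta.
  elim/big_ind2: _ => [|x1 x2 y1 y2 h1 h2|//]; first by rewrite is_norm0.
  by rewrite (le_trans (is_normD _ _)) // lerD.
rewrite mulrDl mul1r mulr_suml ler_wpDl // ler_sum // => j _.
rewrite is_normZ mulrC ler_wpM2l ?is_norm_ge0 //.
rewrite [leRHS]/Num.norm /= mx_normrE.
exact: (le_bigmax _ (fun ij : 'I_1 * 'I_d => `|x ij.1 ij.2|) (0, j)).
Qed.

Lemma is_norm_continuous : continuous N.
Proof.
have [K K0 NK] := is_norm_le_mx_norm.
move=> x; apply/(@cvgrPdist_lt _ _ _ (nbhs x) (nbhs_filter x)) => e e0.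
near=> y.
have : `|N x - N y| <= N (x - y).
  rewrite ler_norml; have := is_normD (x - y) y; have := is_normD (y - x) x.
  by rewrite !subrK -[N (y - x)]is_normN opprB; lra.
move=> /le_lt_trans; apply; apply: le_lt_trans (NK _) _.
rewrite mulrC -ltr_pdivlMr //; near: y.
by apply: cvgr_dist_lt => //; rewrite divr_gt0.
Unshelve. all: by end_near. Qed.

Lemma ndist_continuous x : continuous (fun y => ndist N y x).
Proof.
move=> y; apply: (@cvg_comp _ _ _ (fun y => y - x) N _ (nbhs (y - x))).
  apply: (@cvgB _ _ _ (nbhs y) (nbhs_filter y)); first exact: cvg_id.
  exact: (@cvg_cst _ _ _ (nbhs y) (nbhs_filter y)).
exact: is_norm_continuous.
Qed.

(** The continuous function [N] has a positive minimum on the compact unit sphere of the max norm,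
    and homogeneity extends the bound. It makes [N]-balls bounded in the ambient topology. *)
Lemma is_norm_ge_mx_norm : exists2 c, 0 < c & forall x, c * `|x| <= N x.
Proof.
pose A := [set x : 'rV[R]_d | `|x| = 1].
have unitA x : x != 0 -> A (`|x|^-1 *: x).
  by move=> x0; rewrite /A /= normrZ normfV normr_id mulVf // normr_eq0.
(* If the sphere is empty, zero is the only vector and any constant works. *)
have [A0|A0] := pselect (A !=set0); last first.
  exists 1 => // x; have [->|/unitA Ax] := eqVneq x 0.
    by rewrite normr0 mulr0 is_norm_ge0.
  by exfalso; apply: A0; exists (`|x|^-1 *: x).
have cA : compact A.
  apply: bounded_closed_compact.
    by exists 1; split=> // M M1 x /= ->; exact: ltW.
  apply: (@preimage_closed _ _ (@Num.norm _ 'rV[R]_d) [set 1]).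
    by move=> x _; exact: norm_continuous.
  exact: closed_eq.
have [x0] := compact_EVT_min A0 cA (continuous_subspaceT is_norm_continuous).
rewrite inE => Ax0 minx0; exists (N x0).
  by apply: is_norm_gt0; apply: contra_eq_neq Ax0 => ->; rewrite normr0 eq_sym oner_eq0.
move=> x; have [->|xn0] := eqVneq x 0; first by rewrite normr0 mulr0 is_norm_ge0.
have := minx0 (`|x|^-1 *: x); rewrite inE => /(_ (unitA _ xn0)).
by rewrite is_normZ normfV normr_id ler_pdivlMl ?normr_gt0 // mulrC.
Qed.

Lemma nball_closed B : closed (nball N B).
Proof.
apply: (@preimage_closed _ _ (fun y => ndist N y (bcenter B)) [set t | t <= brad B]).
  by move=> x _; exact: ndist_continuous.
exact: closed_le.
Qed.

Lemma nball_compact B : compact (nball N B).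
Proof.
apply: bounded_closed_compact (@nball_closed B).
have [c c0 cN] := is_norm_ge_mx_norm.
exists (c^-1 * (brad B + N (bcenter B))); split; first exact: num_real.
move=> M /ltW BM x /= xB; apply: le_trans BM.
rewrite ler_pdivlMl //; apply: le_trans (cN _) _.
have := ndist_triangle (bcenter B) x 0; rewrite {1 3}/ndist !subr0.
by move=> /le_trans; apply; rewrite lerD2r.
Qed.

Lemma nball_center B : 0 <= brad B -> nball N B (bcenter B).
Proof. by rewrite /nball /= ndistxx. Qed.

(** Two antipodal points of [B], at distance [2 * brad B], both lie in [B']. In dimension 0 all
    balls of nonnegative radius coincide, hence the condition on [d]. *)
Lemma nball_sub_brad B B' : (0 < d)%N -> 0 <= brad B ->
  nball N B `<=` nball N B' -> brad B <= brad B'.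
Proof.
move=> d0 B0 sBB'; pose v : 'rV[R]_d := const_mx 1.
have v0 : 0 < N v.
  apply/is_norm_gt0/eqP => /matrixP /(_ 0 (Ordinal d0)).
  by rewrite !mxE; exact/eqP/oner_neq0.
pose w := (brad B / N v) *: v.
have Nw : N w = brad B.
  by rewrite is_normZ ger0_norm ?divr_ge0 ?is_norm_ge0 // divfK ?gt_eqF.
have /sBB' /= h1 : nball N B (bcenter B + w).
  by rewrite /nball /ndist /= addrAC subrr add0r Nw.
have /sBB' /= h2 : nball N B (bcenter B - w).
  by rewrite /nball /ndist /= addrAC subrr add0r is_normN Nw.
have := ndist_triangle (bcenter B') (bcenter B + w) (bcenter B - w).
rewrite [ndist N (bcenter B') _]ndistC.
have -> : ndist N (bcenter B + w) (bcenter B - w) = 2 * brad B.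
  rewrite /ndist opprD opprK addrACA subrr add0r -mulr2n -scaler_nat.
  by rewrite is_normZ Nw ger0_norm.
by move: h1 h2; rewrite /nball /=; lra.
Qed.

Lemma nball_sub B B' : ndist N (bcenter B) (bcenter B') + brad B <= brad B' ->
  nball N B `<=` nball N B'.
Proof.
move=> h x; rewrite /nball /=.
by have := ndist_triangle (bcenter B) x (bcenter B'); lra.
Qed.

Lemma nball_inner B y t : 0 < t -> t <= brad B -> nball N B y ->
  exists2 c, nball N (c, t) y & nball N (c, t) `<=` nball N B.
Proof.
move=> t0 tB yB; have B0 : 0 < brad B by lra.
set s := brad B in tB B0 *; set b := bcenter B.
have ts0 : 0 <= t / s by rewrite divr_ge0 // ltW.
have ts1 : t / s <= 1 by rewrite ler_pdivrMr // mul1r.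
have yb : N (y - b) <= s by [].
(* The image of the centre [b] under the homothety with centre [y] and ratio [t / s], which maps [B]
   into itself. *)
exists (y - (t / s) *: (y - b)).
  rewrite /nball /ndist /= opprB addrC subrK is_normZ ger0_norm //.
  by rewrite -[leRHS](divfK (lt0r_neq0 B0)) ler_wpM2l.
apply: nball_sub; rewrite /ndist /= addrAC -[X in X - _]scale1r -scalerBl.
rewrite is_normZ ger0_norm ?subr_ge0 //.
have -> : brad B = (1 - t / s) * s + t by field; rewrite gt_eqF.
by rewrite lerD2r ler_wpM2l ?subr_ge0.
Qed.

Lemma compact_ndist_gt0 (A B : set 'rV[R]_d) : compact A -> compact B ->
  ~ (A `&` B !=set0) ->
  exists2 e, 0 < e & forall x y, A x -> B y -> e <= ndist N x y.
Proof.
move=> cA cB AB0.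
have [AB|AB] := pselect (A `*` B !=set0); last first.
  by exists 1 => // x y Ax By; exfalso; apply: AB; exists (x, y).
have cf : continuous (fun p : 'rV[R]_d * 'rV[R]_d => ndist N p.1 p.2).
  move=> p; apply: (@cvg_comp _ _ _ (fun p : 'rV[R]_d * 'rV[R]_d => p.1 - p.2) N _ (nbhs (p.1 - p.2))).
    by apply: (@cvgB _ _ _ (nbhs p) (nbhs_filter p)); [exact: cvg_fst|exact: cvg_snd].
  exact: is_norm_continuous.
have [[x y]] := compact_EVT_min AB (compact_setX cA cB) (continuous_subspaceT cf).
rewrite inE => -[/= Ax By] minxy; exists (ndist N x y).
  apply: is_norm_gt0; rewrite subr_eq0; apply/eqP => xy.
  by apply: AB0; exists x; split=> //; rewrite xy.
by move=> u v Au Bv; apply: (minxy (u, v)); rewrite inE.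
Qed.

End Norms.

(** * Words and infinite branches *)

Section Words.
Context {k : seq nat -> nat}.
Implicit Types I J : seq nat.

Lemma word_nil : word_of k [::].
Proof. by []. Qed.

Lemma word_rcons I j : word_of k I -> (j < k I)%N -> word_of k (rcons I j).
Proof.
move=> wI jk n; rewrite size_rcons ltnS leq_eqVlt => /orP[/eqP ->|nI].
  by rewrite nth_rcons ltnn eqxx -cats1 take_size_cat.
by rewrite nth_rcons nI -cats1 takel_cat ?(ltnW nI) //; exact: wI.
Qed.

Lemma word_take m I : word_of k I -> word_of k (take m I).
Proof.
move=> wI n; rewrite size_take_min leq_min => /andP[nm nI].
by rewrite nth_take // take_takel ?(ltnW nm) //; exact: wI.
Qed.

Lemma word_rconsP I j : word_of k (rcons I j) -> word_of k I /\ (j < k I)%N.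
Proof.
move=> wIj; split.
  by have := @word_take (size I) _ wIj; rewrite -cats1 take_size_cat.
have := wIj (size I); rewrite size_rcons ltnSn => /(_ isT).
by rewrite nth_rcons ltnn eqxx -cats1 take_size_cat.
Qed.

Lemma word_mkseq (i : nat -> nat) : (forall n, (i n < k (mkseq i n))%N) ->
  forall n, word_of k (mkseq i n).
Proof.
move=> ik; elim=> [|n IHn]; first exact: word_nil.
by rewrite mkseqS; exact: word_rcons.
Qed.

(** Dependent choice, with the chosen words glued into one index sequence, the form in which a
    system of balls speaks of its branches. *)
Lemma word_path (Q : seq nat -> Prop) I0 : word_of k I0 -> Q I0 ->
    (forall I, word_of k I -> Q I -> exists2 j, (j < k I)%N & Q (rcons I j)) ->
  exists2 i : nat -> nat, (forall n, (i n < k (mkseq i n))%N) &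
    forall n, (size I0 <= n)%N -> Q (mkseq i n).
Proof.
move=> wI0 QI0 Qstep.
have /choice[f fP] I : exists j, word_of k I -> Q I ->
    (j < k I)%N /\ Q (rcons I j).
  have [[wI QI]|nQ] := pselect (word_of k I /\ Q I).
    by have [j jk Qj] := Qstep I wI QI; exists j.
  by exists 0%N => wI QI; exfalso; exact: nQ.
pose g n := iter n (fun I => rcons I (f I)) I0.
have gP n : word_of k (g n) /\ Q (g n).
  elim: n => // n [wg Qg]; have [fk Qf] := fP _ wg Qg.
  by split=> //; exact: word_rcons.
have sg n : size (g n) = (size I0 + n)%N.
  by elim: n => [|n IHn]; rewrite ?addn0 //= size_rcons IHn addnS.
have tg m n : take (size (g m)) (g (m + n)%N) = g m.
  elim: n => [|n IHn]; first by rewrite addn0 take_size.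
  rewrite addnS /= -cats1 takel_cat ?IHn // !sg.
  by rewrite leq_add2l leq_addr.
(* [g n.+1] has more than [n] letters, and later words only extend it, so letter [n] is settled
   there. *)
pose i n := nth 0%N (g n.+1) n.
have iE m n : (m <= size I0 + n)%N -> mkseq i m = take m (g n).
  move=> mn; apply: (@eq_from_nth _ 0%N).
    by rewrite size_mkseq size_takel // sg.
  move=> x; rewrite size_mkseq => xm; rewrite nth_mkseq // nth_take //.
  have nthg p q : (x < size (g p))%N -> nth 0%N (g (p + q)%N) x = nth 0%N (g p) x.
    by move=> xp; rewrite -[in RHS](tg p q) nth_take.
  rewrite /i -(nthg x.+1 n) ?sg ?ltn_addl // addnC nthg // sg.
  exact: leq_trans mn.
exists i => [n|n I0n].
  have h : (n < size I0 + n.+1)%N by rewrite ltn_addl.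
  rewrite (iE _ n.+1) ?(ltnW h) //; apply: (gP n.+1).1.
  by rewrite sg.
have sgn : size (g (n - size I0)%N) = n by rewrite sg subnKC.
rewrite (iE _ (n - size I0)%N) ?subnKC // -{1}sgn take_size.
exact: (gP _).2.
Qed.

End Words.

(** * A single system: nested balls, small balls around points of the set, height and thickness *)

Section Systems.
Context {R : realType} {d : nat} {N : 'rV[R]_d -> R} {C : set 'rV[R]_d}
  {S : seq nat -> ballT R d} {k : seq nat -> nat}.
Hypotheses (normN : is_norm N) (sysC : system_of_balls N C S k).

Lemma system_rad_gt0 I : word_of k I -> 0 < brad (S I).
Proof. by case: sysC => + _ _ _; apply. Qed.

Lemma system_child I j : word_of k I -> (j < k I)%N ->
  nball N (S (rcons I j)) `<=` nball N (S I).
Proof. by case: sysC => _ + _ _; apply. Qed.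

Lemma system_sub_take I m : word_of k I ->
  nball N (S I) `<=` nball N (S (take m I)).
Proof.
elim/last_ind: I => [_ //|I j IHI wIj].
have [wI jk] := word_rconsP wIj.
have [Im|mI] := leqP (size (rcons I j)) m; first by rewrite take_oversize.
rewrite -cats1 takel_cat ?cats1; last by rewrite -ltnS -(size_rcons I j).
exact: subset_trans (system_child wI jk) (IHI wI).
Qed.

Lemma system_rad_root I : (0 < d)%N -> word_of k I -> brad (S I) <= brad (S [::]).
Proof.
move=> d0 wI; apply: (nball_sub_brad normN) => //; first exact/ltW/system_rad_gt0.
by have := @system_sub_take I 0 wI; rewrite take0.
Qed.

Lemma word_path_small_rad (Q : seq nat -> Prop) I0 e : 0 < e ->
    word_of k I0 -> Q I0 ->
    (forall I, word_of k I -> Q I -> exists2 j, (j < k I)%N & Q (rcons I j)) ->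
  exists I, [/\ word_of k I, Q I & brad (S I) < e].
Proof.
move=> e0 wI0 QI0 Qstep; have [i ik Qi] := word_path wI0 QI0 Qstep.
case: sysC => _ _ _ /(_ i ik) /cvgr_lt /(_ e e0) [m _ mP].
exists (mkseq i (maxn m (size I0))); split.
- exact: word_mkseq.
- by apply: Qi; rewrite leq_maxr.
- by apply: mP; rewrite /= leq_maxl.
Qed.

(** Extend [I] to an infinite branch: the nested compact balls along it have a common point, which
    lies in [C]. *)
Lemma system_ball_meets I :
    (forall J, word_of k J -> exists j, (j < k J)%N) -> word_of k I ->
  C `&` nball N (S I) !=set0.
Proof.
move=> kpos wI; pose Q J := nball N (S J) `<=` nball N (S I).
have [|J wJ QJ|i ik Qi] := @word_path k Q I wI; first by [].
  have [j jk] := kpos J wJ; exists j => //.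
  exact: subset_trans (system_child wJ jk) QJ.
have wi := word_mkseq ik.
pose B n := nball N (S (mkseq i n)); pose c n := bcenter (S (mkseq i n)).
have BB m n : (m <= n)%N -> B n `<=` B m.
  move=> mn; rewrite /B; have -> : mkseq i m = take m (mkseq i n).
    by rewrite /mkseq -map_take take_iota (minn_idPl mn).
  exact: system_sub_take.
have cB m : (c @ \oo) (B m).
  exists m => // n /= mn; apply: BB mn _ _.
  exact/nball_center/ltW/system_rad_gt0.
(* A cluster point of the centres: each ball of the branch is closed and contains all centres from
   some rank on. *)
have [z [_]] := @nball_compact _ _ _ normN _ (c @ \oo) _ (cB 0%N).
rewrite clusterE => zB.
have {}zB m : B m z by apply/(nball_closed normN)/zB/cB.
exists z; split; last exact: Qi (leqnn _) _ (zB _).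
case: sysC => _ _ -> _ n _; exists (mkseq i n); last exact: zB.
by rewrite /= size_mkseq.
Qed.

(* König's lemma: the words whose balls contain [y] have extensions of every
   length, so they contain an infinite branch. *)
Lemma system_small_ball y e : C y -> 0 < e ->
  exists I, [/\ word_of k I, nball N (S I) y & brad (S I) < e].
Proof.
move=> Cy e0.
pose Q L := forall m, (size L <= m)%N -> exists L',
  [/\ word_of k L', size L' = m, take (size L) L' = L & nball N (S L') y].
have Q0 : Q [::].
  move=> m _; case: sysC Cy => _ _ -> _ /(_ m Logic.I) [L' [wL' sL'] yL'].
  by exists L'; rewrite take0.
have [L wL QL|L [wL QL rL]] := word_path_small_rad e0 word_nil Q0; last first.
  exists L; split=> //; have [L' [_ sL' tL']] := QL _ (leqnn _).
  by rewrite -tL' -sL' take_size.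
(* Otherwise extensions through each child [j] fail at some length [m j]. As the children are
   finitely many, an extension of [L] longer than all [m j] exists; cut to length [m j] for its own
   next letter [j], it gives a contradiction. *)
apply: contrapT => noj.
have /choice[m mP] j : exists m, (j < k L)%N -> (size L < m)%N /\
    ~ exists L', [/\ word_of k L', size L' = m, take (size L).+1 L' = rcons L j
                   & nball N (S L') y].
  apply: contrapT => nm; apply: noj; exists j.
    by apply: contrapT => njk; apply: nm; exists 0%N.
  move=> m; rewrite size_rcons => Lm; apply: contrapT => nL'.
  by apply: nm; exists m.
pose M := maxn (size L).+1 (\max_(j < k L) m j).
have LM : (size L < M)%N by rewrite leq_maxl.
have [L' [wL' sL' tL' yL']] := QL M (ltnW LM).
pose j := nth 0%N L' (size L).
have jk : (j < k L)%N by rewrite -tL'; apply: wL'; rewrite sL'.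
have mjM : (m j <= M)%N.
  by rewrite leq_max (leq_bigmax (Ordinal jk)) orbT.
have [Lmj] := mP j jk; apply; exists (take (m j) L'); split.
- exact: word_take.
- by rewrite size_takel // sL'.
- by rewrite take_takel // (take_nth 0%N) ?sL' // tL'.
- exact: system_sub_take yL'.
Qed.

(** Drop final letters from the word of a small ball around [y] until the parent has radius at least
    [t]; the bound on the root ensures that this happens. *)
Lemma system_crossing y t : C y -> 0 < t -> t <= brad (S [::]) ->
  exists L j, [/\ word_of k L, (j < k L)%N, t <= brad (S L),
    brad (S (rcons L j)) < t & nball N (S (rcons L j)) y].
Proof.
move=> Cy t0 tS; have [I [wI yI It]] := system_small_ball Cy t0.
elim/last_ind: I wI yI It => [|I j IHI] wI yI It.
  by move: (lt_le_trans It tS); rewrite ltxx.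
have [{}wI jk] := word_rconsP wI.
have [tI|It'] := leP t (brad (S I)); first by exists I, j.
exact: IHI wI (system_child wI jk yI) It'.
Qed.

Lemma dist_set_le x y : C y -> dist_set N x C <= ndist N x y.
Proof.
move=> Cy; apply: ge_inf; last by exists y.
by exists 0 => _ [z _ <-]; exact: ndist_ge0.
Qed.

(** Compactness provides a nearest point of [C], so a bound on the height yields an actual point of
    [C] in a shrunken ball. *)
Lemma hgtS_attained B x : compact C -> C !=set0 -> nball N B x ->
  exists2 z, C z & ndist N x z <= hgtS N C B.
Proof.
move=> cC C0 xB.
have [z] := compact_EVT_min C0 cC (continuous_subspaceT (@ndist_continuous _ _ _ normN x)).
rewrite inE => Cz minz; exists z => //.
apply: (@le_trans _ _ (dist_set N x C)).
  apply: lb_le_inf; first by case: C0 => y Cy; exists (ndist N x y), y.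
  move=> _ [y Cy <-]; rewrite ndistC // [leRHS]ndistC //.
  by apply: minz; rewrite inE.
apply: ub_le_sup; last by exists x.
(* The supremum is over a bounded set: distances to [C] are at most distances to the fixed point
   [z]. *)
exists (brad B + ndist N (bcenter B) z) => _ [y yB <-].
apply: le_trans (dist_set_le y Cz) _.
by apply: le_trans (ndist_triangle normN (bcenter B) y z) _; rewrite lerD2r.
Qed.

Lemma thicknessS_ge0 : compact C -> C !=set0 -> (0 <= thicknessS N C S k)%E.
Proof.
move=> cC C0; apply: le_ereal_inf_tmp => _ [I wI <-].
rewrite /thick_ratio; case: ifP => _ //; apply: mule_ge0.
  apply: le_bigmin => // i _; rewrite lee_fin; apply/ltW/system_rad_gt0.
  exact: word_rcons.
rewrite lee_fin invr_ge0.
have [|z _] := @hgtS_attained (S I) (bcenter (S I)) cC C0.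
  exact/nball_center/ltW/system_rad_gt0.
exact: le_trans (ndist_ge0 normN _ _).
Qed.

Lemma thicknessS_le I j : word_of k I -> (j < k I)%N -> 0 < hgtS N C (S I) ->
  (thicknessS N C S k <= (brad (S (rcons I j)) / hgtS N C (S I))%:E)%E.
Proof.
move=> wI jk h0; apply: (@le_trans _ _ (thick_ratio N C S k I)).
  by apply: ereal_inf_lbound; exists I.
rewrite /thick_ratio gt_eqF // EFinM lee_wpmul2r //.
  by rewrite lee_fin invr_ge0 ltW.
exact: (bigmin_le _ (Ordinal jk)).
Qed.

End Systems.

(** * Two dense systems: the descent through linked balls *)

Lemma unif_dense_child (R : realType) (d : nat) (N : 'rV[R]_d -> R) (r : R)
    (S : seq nat -> ballT R d) (k : seq nat -> nat) J :
  r <= 1 -> 0 <= brad (S J) -> unif_dense N r S k -> word_of k J ->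
  exists j, (j < k J)%N.
Proof.
(* Density is applied to [S J] as a ball inside itself, large enough because [r <= 1]. *)
move=> r1 SJ0 dense wJ; have [//||j jk _] := dense J wJ (S J).
  by rewrite ler_piMl.
by exists j.
Qed.

(* The two sets are indexed by [bool] because the descent keeps exchanging
   their roles. *)
Section GapLemma.
Context {R : realType} {d : nat} {N : 'rV[R]_d -> R} {r : R}
  {C : bool -> set 'rV[R]_d} {S : bool -> seq nat -> ballT R d}
  {k : bool -> seq nat -> nat}.
Hypotheses (normN : is_norm N) (d_gt0 : (0 < d)%N)
  (compactC : forall a, compact (C a)) (C_neq0 : forall a, C a !=set0)
  (sysC : forall a, system_of_balls N (C a) (S a) (k a))
  (r_gt0 : 0 < r) (r2_lt1 : 2 * r < 1)
  (thickC : (((1 - 2 * r) ^+ 2)^-1%:E <=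
     thicknessS N (C true) (S true) (k true) *
     thicknessS N (C false) (S false) (k false))%E)
  (radS : forall a, r * brad (S a [::]) <= brad (S (~~ a) [::]))
  (denseS : forall a, unif_dense N r (S a) (k a)).

Definition linked a I := word_of (k a) I /\
  C (~~ a) `&` nball N (scale_nball (1 - 2 * r) (S a I)) !=set0.

(** If both bounds failed, multiplying them crosswise would make the product of the two
    radius-to-height ratios, hence that of the thicknesses, smaller than [1 / (1 - 2 * r) ^ 2]. *)
Lemma hgtS_dichotomy a I L i j :
  word_of (k a) I -> (i < k a I)%N -> word_of (k (~~ a)) L -> (j < k (~~ a) L)%N ->
  hgtS N (C (~~ a)) (S (~~ a) L) <= (1 - 2 * r) * brad (S a (rcons I i)) \/
  hgtS N (C a) (S a I) <= (1 - 2 * r) * brad (S (~~ a) (rcons L j)).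
Proof.
move=> wI ik wL jk; set c := 1 - 2 * r.
have c0 : 0 < c by rewrite subr_gt0.
have x0 := system_rad_gt0 (sysC a) (word_rcons wI ik).
have y0 := system_rad_gt0 (sysC (~~ a)) (word_rcons wL jk).
set x := brad _ in x0 *; set y := brad _ in y0 *.
have [|h2] := leP (hgtS N (C (~~ a)) (S (~~ a) L)) (c * x); first by left.
have [|h1] := leP (hgtS N (C a) (S a I)) (c * y); first by right.
exfalso.
have cx0 : 0 < c * x by rewrite mulr_gt0.
have cy0 : 0 < c * y by rewrite mulr_gt0.
(* Positive heights rule out the infinite value of the ratio. *)
have h20 := lt_trans cx0 h2; have h10 := lt_trans cy0 h1.
have T1 := thicknessS_le wI ik h10; have T2 := thicknessS_le wL jk h20.
have T0 b := thicknessS_ge0 normN (sysC b) (@compactC b) (C_neq0 b).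
have := lee_pmul (T0 a) (T0 (~~ a)) T1 T2.
have -> : (thicknessS N (C a) (S a) (k a) *
    thicknessS N (C (~~ a)) (S (~~ a)) (k (~~ a)) =
  thicknessS N (C true) (S true) (k true) *
    thicknessS N (C false) (S false) (k false))%E.
  by case: (a) => //=; rewrite muleC.
move=> /(le_trans thickC); rewrite -EFinM lee_fin -/x -/y -/c.
set u := hgtS _ _ _ in h1 h10 *; set v := hgtS _ _ _ in h2 h20 *.
rewrite mulf_div ler_pdivlMr ?mulr_gt0 // ler_pdivrMl ?exprn_gt0 //.
apply/negP; rewrite -ltNge.
have -> : c ^+ 2 * (x * y) = (c * y) * (c * x) by ring.
by rewrite ltr_pM // ltW.
Qed.

Lemma linked_step a I : linked a I ->
  (exists2 i, (i < k a I)%N & linked a (rcons I i)) \/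
  (exists2 L, linked (~~ a) L & brad (S (~~ a) L) < r * brad (S a I)).
Proof.
move=> [wI [y [Cy yI]]]; set rho := brad (S a I).
have rho0 : 0 < rho := system_rad_gt0 (sysC a) wI.
have yI' : ndist N y (bcenter (S a I)) <= (1 - 2 * r) * rho by [].
have rrho0 : 0 < r * rho by rewrite mulr_gt0.
have rrho_root : r * rho <= brad (S (~~ a) [::]).
  apply: le_trans (radS a); rewrite (ler_wpM2l (ltW r_gt0)) //.
  exact: (system_rad_root normN (sysC a)).
have [L [j [wL jk Lrho Ljrho yLj]]] := system_crossing (sysC _) Cy rrho0 rrho_root.
have yL := system_child (sysC _) wL jk yLj.
have [c yc cL] := nball_inner normN rrho0 Lrho yL.
have yc' : ndist N y c <= r * rho := yc.
(* This is where the factor [1 - 2 * r] comes from: [y] is within [(1 - 2 * r) * rho] of the centre,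
   and the small ball through [y] has diameter at most [2 * r * rho]. *)
have cI : nball N (c, r * rho) `<=` nball N (S a I).
  apply: (nball_sub normN) => /=; rewrite -/rho.
  have := ndist_triangle normN y c (bcenter (S a I)).
  by rewrite [ndist N c y](ndistC normN); lra.
have [i ik iB] := denseS wI cI (lexx _).
have wIi := word_rcons wI ik; have wLj := word_rcons wL jk.
have [h|h] := hgtS_dichotomy wI ik wL jk.
  left; exists i => //; split=> //.
  (* The height of [S (~~ a) L] controls the distance from this centre to the other set. *)
  have iL : nball N (S (~~ a) L) (bcenter (S a (rcons I i))).
    apply: cL; apply: iB; apply: (nball_center normN).
    exact/ltW/(system_rad_gt0 (sysC a)).
  have [z Cz zh] := hgtS_attained normN (@compactC (~~ a)) (C_neq0 _) iL.
  exists z; split=> //; rewrite /nball /= (ndistC normN).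
  exact: le_trans zh h.
right; exists (rcons L j) => //; split=> //.
(* The radius of the child is below [r * rho], so its centre is within [(1 - r) * rho] of that of
   [S a I]. *)
have LjI : nball N (S a I) (bcenter (S (~~ a) (rcons L j))).
  rewrite /nball /= -/rho.
  have := ndist_triangle normN y (bcenter (S (~~ a) (rcons L j))) (bcenter (S a I)).
  by move: yLj; rewrite /nball /= (ndistC normN); lra.
have [z Cz zh] := hgtS_attained normN (@compactC a) (C_neq0 a) LjI.
exists z; split; first by rewrite negbK.
rewrite /nball /= (ndistC normN).
exact: le_trans zh h.
Qed.

(* A switch of sides shrinks the radius by the factor [r]; without switches the
   descent follows a branch of one system, along which the radii vanish. *)
Lemma linked_small a I e : linked a I -> 0 < e ->
  exists b J, linked b J /\ brad (S b J) < e.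
Proof.
move=> lI e0; apply: contrapT => nosmall.
have big b J : linked b J -> e <= brad (S b J).
  by move=> lJ; rewrite leNgt; apply/negP => h; apply: nosmall; exists b, J.
pose A := [set brad (S p.1 p.2) | p in [set p | linked p.1 p.2]].
have A0 : A !=set0 by exists (brad (S a I)), (a, I).
have Alb : has_lbound A by exists e => _ [[b J] /= lJ <-]; exact: big.
have m0 : 0 < inf A.
  by apply: lt_le_trans e0 _; apply: lb_le_inf => // _ [[b J] /= lJ <-]; exact: big.
(* Since [r < 1], some linked ball has radius below [inf A / r]; a switch of sides from it would go
   below the infimum. *)
have [_ [[b J] /= lJ <-]] : exists2 x, A x & x < inf A / r.
  have e1 : 0 < inf A / r - inf A.
    rewrite subr_gt0 ltr_pdivlMr // gtr_pMr //.
    by have := r_gt0; have := r2_lt1; lra.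
  have [x Ax] := inf_adherent e1 (conj A0 Alb).
  by rewrite subrKC; exists x.
rewrite ltr_pdivlMr // mulrC => Jsmall.
pose Q K := linked b K /\ r * brad (S b K) < inf A.
have [K wK [lK QK]|K [wK [lK _] Ke]] :=
    @word_path_small_rad _ _ _ _ _ _ (sysC b) Q J e e0 lJ.1 (conj lJ Jsmall).
  have [[i ik li]|[L lL Lr]] := linked_step lK.
    exists i => //; split=> //; apply: le_lt_trans QK.
    rewrite (ler_wpM2l (ltW r_gt0)) //; apply: (nball_sub_brad normN d_gt0).
      exact/ltW/(system_rad_gt0 (sysC b))/li.1.
    exact: (system_child (sysC b)).
  exfalso; have : inf A <= brad (S (~~ b) L) by apply: ge_inf => //; exists (~~ b, L).
  by lra.
by have := big _ _ lK; lra.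
Qed.

Lemma linked_meet a I : linked a I -> C true `&` C false !=set0.
Proof.
move=> lI; apply: contrapT => dis.
have [e e0 eP] := compact_ndist_gt0 normN (@compactC true) (@compactC false) dis.
have {}eP b x y : C b x -> C (~~ b) y -> e <= ndist N x y.
  by case: b => /= Cx Cy; [|rewrite (ndistC normN)]; exact: eP.
(* Both a point of [C b] and one of the other set lie within one radius of the centre, hence at
   distance less than [e]. *)
have [b [J [[wJ [y [Cy yJ]]] Je]]] : exists b J, linked b J /\ brad (S b J) < e / 2.
  by apply: linked_small lI _; rewrite divr_gt0.
have [|x [Cx xJ]] := system_ball_meets normN (sysC b) _ wJ.
  move=> K wK; apply: (unif_dense_child _ _ (@denseS b) wK).
    by have := r_gt0; have := r2_lt1; lra.
  exact/ltW/(system_rad_gt0 (sysC b)).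
have J0 := system_rad_gt0 (sysC b) wJ.
have := eP b x y Cx Cy; have := ndist_triangle normN (bcenter (S b J)) x y.
rewrite [ndist N (bcenter _) y](ndistC normN).
move: xJ yJ; rewrite /nball /=.
have : (1 - 2 * r) * brad (S b J) <= brad (S b J) 
  by rewrite ler_piMl ?(ltW J0) //; have := r_gt0; lra.
by lra.
Qed.

End GapLemma.

Theorem theorem1p1 (R : realType) (d : nat) (N : 'rV[R]_d -> R)
    (C1 C2 : set 'rV[R]_d)
    (S1 S2 : seq nat -> ballT R d) (k1 k2 : seq nat -> nat) (r : R) :
  is_norm N ->
  compact C1 -> compact C2 ->
  system_of_balls N C1 S1 k1 -> system_of_balls N C2 S2 k2 ->
  0 < r -> r < 2^-1 ->
  (((1 - 2 * r) ^+ 2)^-1%:E <= thicknessS N C1 S1 k1 * thicknessS N C2 S2 k2)%E ->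
  C1 `&` nball N (scale_nball (1 - 2 * r) (S2 [::])) !=set0 ->
  r * brad (S2 [::]) <= brad (S1 [::]) ->
  r * brad (S1 [::]) <= brad (S2 [::]) ->
  unif_dense N r S1 k1 -> unif_dense N r S2 k2 ->
  C1 `&` C2 !=set0.
Proof.
move=> normN cC1 cC2 sC1 sC2 r0 r12 thick meet rad1 rad2 dense1 dense2.
have [y [C1y yS2]] := meet.
have [|z [C2z _]] := system_ball_meets normN sC2 _ (@word_nil k2).
  move=> K wK; apply: (unif_dense_child _ _ dense2 wK); first by lra.
  exact/ltW/(system_rad_gt0 sC2).
(* In dimension 0 the space is a single point, so nonempty sets meet. *)
have [d0|d_gt0] := posnP d.
  by exists y; split=> //; subst d; rewrite (_ : y = z) // thinmx0 [z]thinmx0.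
pose C a := if a then C1 else C2.
pose S a := if a then S1 else S2.
pose k a := if a then k1 else k2.
have C0 a : C a !=set0 by case: a; [exists y|exists z].
have r2_lt1 : 2 * r < 1 by rewrite -ltr_pdivlMl ?mulr1.
(* The descent starts on side [false]: hypothesis (ii) says that the root ball of the second system
   is linked. *)
apply: (@linked_meet R d N r C S k normN d_gt0 _ C0 _ r0 r2_lt1 thick _ _ false [::]).
1-4: by case.
by split.
Qed.
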